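(* Each $\kappa$-Fréchet–Urysohn Tychonoff space $X$ is Ascoli.
   Context: Tychonoff means completely regular and Hausdorff. A topological space $X$ is $\kappa$-Fréchet–Urysohn if for every open subset $U$ of $X$ and every $x\in\overline{U}$ there is a sequence $\{x_n\}_{n\in\mathbb N}\subseteq U$ converging to $x$. $C_k(X)$ is the space of all continuous real-valued functions on $X$ with the compact-open topology. A Tychonoff space $X$ is Ascoli if every compact subset $\mathcal K$ of $C_k(X)$ is evenly continuous, i.e. the map $\mathcal K\times X\to\mathbb R$, $(f,x)\mapsto f(x)$, is continuous. *)

(* Defs.v *)
From HB Require Import structures.
From mathcomp Require Import all_boot all_order all_algebra.
From mathcomp Require Import all_classical all_reals all_analysis.
Import numFieldNormedType.Exports.

Set Implicit Arguments.
Unset Strict Implicit.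
Unset Printing Implicit Defensive.

Local Open Scope classical_set_scope.
Local Open Scope ring_scope.

(* completely_regular_space is stated with a uniformity coarser than the topology
   of X; by uniform_separatorP, this is the separation of points from closed sets
   by continuous real-valued functions, without any T1 requirement. *)
Definition tychonoff_space (X : topologicalType) : Prop :=
  completely_regular_space X /\ hausdorff_space X.

Definition kappa_frechet_urysohn (X : topologicalType) : Prop :=
  forall (U : set X) (x : X), open U -> closure U x ->
    exists u : nat -> X, (forall n, U (u n)) /\ u @ \oo --> x.

(* The carrier of Ck X Y is the type of bundled continuous functions, with the
   subspace topology inherited from the compact-open topology on X -> Y. *)
Definition Ck (X Y : topologicalType) : Type :=
  initial_topology
    (fun f : continuousType X Y => (f : X -> Y) : {compact-open, X -> Y}).

HB.instance Definition _ (X Y : topologicalType) := Topological.on (Ck X Y).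

Definition Ck_eval (X Y : topologicalType) (p : Ck X Y * X) : Y :=
  (p.1 : continuousType X Y) p.2.

(* The product of K and X carries the subspace topology of Ck X Y * X, which is
   also the product of the subspace topology of K with the topology of X. *)
Definition evenly_continuous (X Y : topologicalType) (K : set (Ck X Y)) : Prop :=
  {within K `*` [set: X], continuous (@Ck_eval X Y)}.

Definition ascoli_space (R : realType) (X : topologicalType) : Prop :=
  tychonoff_space X /\
  forall K : set (Ck X R), compact K -> evenly_continuous K.

(* Main.v *)
Require Import Defs.
From mathcomp Require Import all_boot all_order all_algebra.
From mathcomp Require Import all_classical all_reals all_analysis.
Import Order.TTheory GRing.Theory Num.Theory numFieldNormedType.Exports.

Set Implicit Arguments.
Unset Strict Implicit.
Unset Printing Implicit Defensive.

Local Open Scope classical_set_scope.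
Local Open Scope ring_scope.

(** The idea is that a compact set K of continuous functions behaves uniformly
    along every convergent sequence, and that the kappa-Frechet-Urysohn property
    turns any failure of equicontinuity into a failure along a sequence.

    A convergent sequence together with its limit is a compact set
    (compact_setU1_cvg_image), so the compact-open topology controls functions
    on it.  If f_n lies in K and u_n tends to x, take a cluster point g of
    (f_n): on a tail of the sequence and at x the function g stays near g(x),
    hence so does f_n for some large n, and f_n(u_n) is close to f_n(x)
    (compact_Ck_cvg_close).

    Now suppose that K is not equicontinuous at x.  The points y for which some
    f in K has |f(x) - f(y)| > e then form, for some e, an open set with x in
    its closure.  A sequence u_n in this set tending to x, with witnesses f_n in
    K, contradicts the previous paragraph.  So K is equicontinuous
    (compact_Ck_equicontinuous), and an equicontinuous set is evenly continuous
    because f(y) - f0(x) is the sum of f(y) - f(x), small uniformly in f, and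
    f(x) - f0(x), small for f near f0. *)

(** A filter that does not cluster at the limit avoids a neighbourhood of it,
    hence lives on finitely many terms of the sequence.  Arbitrary index sets I
    are allowed so that the lemma applies to tails. *)
Lemma compact_setU1_cvg_image (X : topologicalType) (u : nat -> X) (x : X)
    (I : set nat) :
  u @ \oo --> x -> compact (x |` u @` I).
Proof.
move=> ux F FF FC.
have [clFx|nclFx] := pselect (cluster F x); first by exists x; split=> //; left.
have [B [V [FB [xV BV0]]]] : exists B V, F B /\ nbhs x V /\ B `&` V = set0.
  apply/not_existsP => h; apply: nclFx => B V FB xV.
  by apply/set0P/eqP => BV; apply: (h B); exists V.
have [N _ NV] : \forall n \near \oo, V (u n) by exact: ux.
(* The terms from N on lie in V, which B avoids, so the following finite
   set belongs to F. *)
have cF : compact (u @` (I `&` `I_N)).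
  exact/finite_compact/finite_image/finite_setIr/finite_II.
have [|y [[n [In _] <-] cly]] := cF F FF; last first.
  by exists (u n); split=> //; right; exists n.
apply: filterS (filterI FC FB) => y [Cy By].
have nVy : ~ V y by move=> Vy; have : (B `&` V) y by []; rewrite BV0.
case: Cy => [yx|[n In uny]].
  by case: nVy; rewrite yx; exact: nbhs_singleton.
exists n => //; split=> //=; rewrite ltnNge; apply/negP => Nn.
by apply: nVy; rewrite -uny; exact: NV.
Qed.

Lemma Ck_eval_continuous (X Y : topologicalType) (f : Ck X Y) :
  continuous (fun x => Ck_eval (f, x)).
Proof. exact: (@cts_fun _ _ (f : continuousType X Y)). Qed.

Lemma open_Ck_image_sub (X Y : topologicalType) (C : set X) (O : set Y) :
  compact C -> open O ->
  open [set g : Ck X Y | forall y, C y -> O (Ck_eval (g, y))].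
Proof.
move=> cC oO; exists [set h : {compact-open, X -> Y} | h @` C `<=` O].
  exact: compact_open_open.
by apply/seteqP; split=> g /= gC; [move=> y Cy; apply: gC; exists y|
  move=> _ [y Cy <-]; exact: gC].
Qed.

(** Compact-open neighbourhoods given by a single point suffice to control
    f(x) - f0(x); equicontinuity does the rest. *)
Lemma equicontinuous_evenly_continuous (R : realFieldType)
    (X : topologicalType) (V : pseudoMetricNormedZmodType R)
    (K : set (Ck X V)) :
  (forall x e, 0 < e -> \forall y \near x, forall f, K f ->
    `|Ck_eval (f, x) - Ck_eval (f, y)| < e) ->
  evenly_continuous K.
Proof.
move=> eqK; apply/subspace_continuousP => -[f x] [/= Kf _].
apply/cvgrPdist_lt => e e0; have e20 : 0 < e / 2 by rewrite divr_gt0.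
pose W := [set g : Ck X V |
  forall y, [set x] y -> ball (Ck_eval (f, x)) (e / 2) (Ck_eval (g, y))].
have fW : nbhs f W.
  apply: open_nbhs_nbhs; split; last by move=> _ ->; exact: ballxx.
  exact: open_Ck_image_sub (@compact_set1 _ x) (ball_open _ _).
exists (W, [set y | forall g, K g ->
          `|Ck_eval (g, x) - Ck_eval (g, y)| < e / 2]).
  by split => //; exact: eqK.
move=> [g y] [/= gx gy] [/= Kg _].
have := gx x erefl; rewrite -ball_normE /= => fgx.
rewrite (le_lt_trans (ler_distD (Ck_eval (g, x)) _ _))// (splitr e).
by rewrite ltrD// gy.
Qed.

(** Comparing f n with a cluster point g of the sequence f, on a tail of u where
    g is already nearly constant, brings both f n x and f n (u n) close to g x. *)
Lemma compact_Ck_cvg_close (R : realFieldType) (X : topologicalType)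
    (V : pseudoMetricNormedZmodType R) (K : set (Ck X V))
    (f : nat -> Ck X V) (u : nat -> X) (x : X) (e : R) :
  compact K -> (forall n, K (f n)) -> u @ \oo --> x -> 0 < e ->
  exists n, `|Ck_eval (f n, x) - Ck_eval (f n, u n)| < e.
Proof.
move=> cK Kf ux e0; have e20 : 0 < e / 2 by rewrite divr_gt0.
have [|g [_ clg]] := cK (f @ \oo) (fmap_proper_filter _ _).
  by exists 0%N => // n _; exact: Kf.
pose B := ball (Ck_eval (g, x)) (e / 2).
(* Only a tail is mapped into B by g, so W must constrain functions on it alone. *)
have [N _ NB] : \forall n \near \oo, B (Ck_eval (g, u n)).
  have gx : Ck_eval (g, y) @[y --> x] --> Ck_eval (g, x).
    exact: Ck_eval_continuous.
  by apply: (cvg_comp _ _ ux gx); exact: nbhsx_ballx.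
pose C := x |` u @` [set n | (N <= n)%N].
pose W := [set h : Ck X V | forall y, C y -> B (Ck_eval (h, y))].
have gW : nbhs g W.
  apply: open_nbhs_nbhs; split.
    apply: open_Ck_image_sub; first exact: compact_setU1_cvg_image.
    exact: ball_open.
  by move=> y [->|[n Nn <-]]; [exact: ballxx|exact: NB].
have fN : (f @ \oo) (f @` [set n | (N <= n)%N]).
  by exists N => // n Nn; exists n.
have [_ [[n Nn <-] fnW]] := clg _ _ fN gW; exists n.
have := fnW _ (or_introl erefl); have : B (Ck_eval (f n, u n)).
  by apply: fnW; right; exists n.
rewrite /B -ball_normE /= => gu gx.
rewrite (le_lt_trans (ler_distD (Ck_eval (g, x)) _ _))// (splitr e).
by rewrite ltrD// distrC.
Qed.

(** The points where equicontinuity at x fails form an open set; were x in its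
    closure, a sequence of such points would converge to x, against the
    behaviour of K along convergent sequences. *)
Lemma compact_Ck_equicontinuous (R : realFieldType) (X : topologicalType)
    (V : pseudoMetricNormedZmodType R) (K : set (Ck X V)) (x : X) (e : R) :
  kappa_frechet_urysohn X -> compact K -> 0 < e ->
  \forall y \near x, forall f, K f -> `|Ck_eval (f, x) - Ck_eval (f, y)| < e.
Proof.
move=> kfuX cK e0; have e20 : 0 < e / 2 by rewrite divr_gt0.
(* With e / 2 and a strict inequality U is open, and it contains every y at
   which some f in K violates the bound e. *)
pose U := \bigcup_(f in K)
  [set y | e / 2 < `|Ck_eval (f, x) - Ck_eval (f, y)|].
have oU : open U.
  apply: bigcup_open => f _.
  apply: (@open_comp _ _ (fun y => `|Ck_eval (f, x) - Ck_eval (f, y)|)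
    [set r | e / 2 < r]); last exact: open_gt.
  move=> y _; apply: cvg_norm; apply: cvgB; first exact: cvg_cst.
  exact: Ck_eval_continuous.
have nclU : ~ closure U x.
  move=> /(kfuX _ _ oU)[u [Uu ux]].
  have /choice[f fP] n : exists f : Ck X V,
      K f /\ e / 2 < `|Ck_eval (f, x) - Ck_eval (f, u n)|.
    by have [f Kf fu] := Uu n; exists f.
  have [n] := compact_Ck_cvg_close cK (fun n => (fP n).1) ux e20.
  by rewrite ltNge (ltW (fP n).2).
have {nclU}[B [xB BU]] : exists B, nbhs x B /\ U `&` B = set0.
  apply/not_existsP => h; apply: nclU => B xB.
  by apply/set0P/eqP => UB; apply: (h B).
apply: filterS xB => y By f Kf; rewrite ltNge; apply/negP => ef.
suff : (U `&` B) y by rewrite BU.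
split=> //; exists f => //=; apply: lt_le_trans ef.
by rewrite ltr_pdivrMr// ltr_pMr// ltr1n.
Qed.

Theorem theorem2p5 (R : realType) (X : topologicalType)
    (tychX : tychonoff_space X) (kfuX : kappa_frechet_urysohn X) :
  ascoli_space R X.
Proof.
split=> // K cK; apply: equicontinuous_evenly_continuous => x e e0.
exact: compact_Ck_equicontinuous.
Qed.
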